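(* Let $0 < k < n$ be integers and let $K$ be a field. Then the Stanley--Reisner ideal of the van der Waerden complex $\mathtt{vdW}(n,k)$ in $K[x_1,\ldots,x_n]$ has linear resolution if and only if either $k=1$ or $\frac{n}{2} \leq k < n$.
   Context: For integers $0<k<n$, the van der Waerden complex $\mathtt{vdW}(n,k)$ is the simplicial complex on the vertex set $\{1,\ldots,n\}$ whose facets are all the arithmetic sequences of length $k$ in $\{1,\ldots,n\}$, that is, all sets $\{a, a+j, a+2j,\ldots,a+kj\}$ with integers $a\geq 1$, $j\geq 1$ and $a+kj\leq n$ (the length $k$ is the number of steps, so each facet has $k+1$ elements). The Stanley--Reisner ideal of a simplicial complex $\Delta$ on $\{1,\ldots,n\}$ is the ideal of $R=K[x_1,\ldots,x_n]$ (standard grading) generated by the squarefree monomials $\prod_{i\in N}x_i$ over all non-faces $N$ of $\Delta$. A homogeneous ideal $I\subseteq R$ has linear resolution if all the (minimal) generators of $I$ have the same degree $d$ for some integer $d\geq 1$ and the graded Betti numbers satisfy $\beta_{i,i+j}(I)=0$ for all $i$ and all $j\neq d$ (so the zero ideal satisfies this vacuously). *)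

(* Defs.v *)
From mathcomp Require Import all_boot all_order all_algebra.
From mathcomp Require Export mpoly.

Set Implicit Arguments.
Unset Strict Implicit.
Unset Printing Implicit Defensive.

Import GRing.Theory.
Local Open Scope ring_scope.

(* The vertex set {1, ..., n} is represented by 'I_n, the ordinal i standing
   for the vertex i.+1.  The void complex (no face at all) is allowed. *)
Record simplicial_complex (n : nat) := SimplicialComplex {
  faces :> {set {set 'I_n}};
  faces_closed :
    forall F G : {set 'I_n}, F \in faces -> G \subset F -> G \in faces
}.

Definition facets (n : nat) (D : simplicial_complex n) : {set {set 'I_n}} :=
  [set F in faces D | [forall G in faces D, (F \subset G) ==> (G == F)]].

Definition generated_faces (n : nat) (A : {set {set 'I_n}}) :
    {set {set 'I_n}} :=
  [set F : {set 'I_n} | [exists G in A, F \subset G]].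

Lemma generated_faces_closed (n : nat) (A : {set {set 'I_n}})
    (F G : {set 'I_n}) :
  F \in generated_faces A -> G \subset F -> G \in generated_faces A.
Proof.
rewrite !inE => /existsP[H /andP[HA FH]] GF.
by apply/existsP; exists H; rewrite HA (subset_trans GF FH).
Qed.

Definition generated_complex (n : nat) (A : {set {set 'I_n}}) :
    simplicial_complex n :=
  SimplicialComplex (@generated_faces_closed n A).

(* The set {a, a + j, ..., a + k * j}, cut down to {1, ..., n}. *)
Definition progression (n k a j : nat) : {set 'I_n} :=
  [set i : 'I_n | [exists m : 'I_k.+1, i.+1 == a + m * j]%N].

(* Since k > 0 in all uses, a + k * j <= n bounds both a and j by n, so
   ranging over 'I_n.+1 loses no progression. *)
Definition arith_sequences (n k : nat) : {set {set 'I_n}} :=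
  [set progression n k (val u.1) (val u.2) | u : 'I_n.+1 * 'I_n.+1
     & [&& 1 <= u.1, 1 <= u.2 & u.1 + k * u.2 <= n]%N].

Definition vdW (n k : nat) : simplicial_complex n :=
  generated_complex (arith_sequences n k).

Lemma card_progression (n k a j : nat) :
  (0 < a)%N -> (0 < j)%N -> (a + k * j <= n)%N ->
  #|progression n k a j| = k.+1.
Proof.
move=> a0 j0 le_n.
have lt_n (m : 'I_k.+1) : ((a + m * j).-1 < n)%N.
  rewrite prednK ?addn_gt0 ?a0 //; apply: leq_trans le_n.
  by rewrite leq_add2l leq_mul2r -ltnS ltn_ord orbT.
pose f m := Ordinal (lt_n m).
have f_inj : injective f.
  move=> x y /(congr1 val)/(congr1 S) /=.
  rewrite !prednK ?addn_gt0 ?a0 // => /addnI/eqP.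
  by rewrite eqn_pmul2r // => /eqP/val_inj.
rewrite -[RHS]card_ord -(card_imset predT f_inj); apply: eq_card => i.
rewrite inE; apply/existsP/imsetP => [[m /eqP im]|[m _ ->]]; exists m => //=.
  by apply/val_inj; rewrite /= -im.
by rewrite prednK ?addn_gt0 ?a0.
Qed.

Lemma facets_vdW (n k : nat) : facets (vdW n k) = arith_sequences n k.
Proof.
have card_arith G : G \in arith_sequences n k -> #|G| = k.+1.
  by case/imsetP=> u; rewrite inE => /and3P[? ? ?] ->; rewrite card_progression.
have arith_face G : G \in arith_sequences n k -> G \in faces (vdW n k).
  by move=> GA; rewrite inE; apply/existsP; exists G; rewrite GA subxx.
apply/setP=> F; rewrite inE; apply/andP/idP => [[]|FA].
  rewrite inE => /existsP[G /andP[GA FG]] /forallP/(_ G).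
  by rewrite arith_face //= FG => /eqP <-.
split; first exact: arith_face.
apply/forallP=> H; apply/implyP; rewrite inE => /existsP[G /andP[GA HG]].
apply/implyP=> FH.
have /eqP FG : F == G.
  by rewrite eqEcard (subset_trans FH HG) (card_arith F) ?(card_arith G) /=.
by rewrite eqEsubset FH andbT FG.
Qed.

Section Ideals.
Variables (K : fieldType) (n : nat).
Implicit Types (I : {mpoly K[n]} -> Prop) (s : seq {mpoly K[n]}).

Definition ideal_gen s : {mpoly K[n]} -> Prop := fun p =>
  exists c : 'I_(size s) -> {mpoly K[n]},
    p = \sum_(i < size s) c i * s`_i.

Definition stanley_reisner (D : simplicial_complex n) : {mpoly K[n]} -> Prop :=
  ideal_gen [seq \prod_(i in N) 'X_i | N : {set 'I_n} in ~: faces D].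

(* Irredundance forces all members of s to be distinct and nonzero. *)
Definition minimal_generators I s : Prop :=
  [/\ (forall g, g \in s -> exists d : nat, g \is d.-homog),
      (forall p, I p <-> ideal_gen s p)
    & (forall t, subseq t s -> (forall p, I p <-> ideal_gen t p) -> t = s)].

(* Matrix data of a sequence
     ... -> F_2 -> F_1 -> F_0 -> R,   F_i = \bigoplus_(a < rk i) R(- shift a),
   where F_i consists of row vectors and the maps act on the right:
   aug : F_0 -> R and diff i : F_(i+1) -> F_i. *)
Record free_sequence := FreeSequence {
  rk : nat -> nat;
  shift : forall i : nat, 'I_(rk i) -> nat;
  aug : 'cV[{mpoly K[n]}]_(rk 0);
  diff : forall i : nat, 'M[{mpoly K[n]}]_(rk i.+1, rk i)
}.

(* All maps are homogeneous of degree 0 with respect to the shifts.  The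
   additive form of the second clause makes an entry vanish when its expected
   degree would be negative. *)
Definition graded (F : free_sequence) : Prop :=
  (forall a, aug F a 0 \is (shift a).-homog) /\
  (forall i a b m, m \in msupp (diff F i a b) ->
     (mdeg m + shift b = shift a)%N).

Definition resolves (F : free_sequence) I : Prop :=
  [/\ (forall p, I p <-> exists u : 'rV_(rk F 0), u *m aug F = p%:M),
      (forall u : 'rV_(rk F 0),
         u *m aug F = 0 <-> exists v, u = v *m diff F 0)
    & (forall i (u : 'rV_(rk F i.+1)),
         u *m diff F i = 0 <-> exists v, u = v *m diff F i.+1)].

(* Each differential maps into (x_1, ..., x_n) F_i. *)
Definition minimal (F : free_sequence) : Prop :=
  forall i a b, (diff F i a b)@_0%MM = 0.

Definition minimal_graded_free_resolution (F : free_sequence) I : Prop :=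
  [/\ graded F, resolves F I & minimal F].

(* beta i j is the number of copies of R(-j) in step i of a minimal graded
   free resolution of I; these numbers do not depend on the resolution. *)
Definition graded_betti_numbers I (beta : nat -> nat -> nat) : Prop :=
  exists F : free_sequence, minimal_graded_free_resolution F I /\
    forall i j, beta i j = #|[set a : 'I_(rk F i) | shift a == j]|.

Definition linear_resolution I : Prop :=
  exists d : nat, exists beta : nat -> nat -> nat,
    [/\ (1 <= d)%N,
        (forall s, minimal_generators I s -> forall g, g \in s -> g \is d.-homog),
        graded_betti_numbers I beta
      & (forall i j : nat, j <> d -> beta i (i + j)%N = 0%N)].

End Ideals.

Arguments stanley_reisner K {n} D.

(* Main.v *)
Require Import Defs.
From mathcomp Require Import all_boot all_order all_algebra.
From mathcomp Require Import zify ring.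
From Stdlib Require Import ClassicalEpsilon.

Set Implicit Arguments.
Unset Strict Implicit.
Unset Printing Implicit Defensive.

Import GRing.Theory.
Local Open Scope ring_scope.

(** Existence of linear resolutions rests on linear quotients.  A finite list
of rows over the polynomial ring has linear quotients when, for each row, the
polynomials multiplying it into the span of the preceding rows form an ideal
generated by variables.  If row i has the variables L i, then each variable t
of L i yields a syzygy whose top component is x_t at i, and these syzygies,
ordered lexicographically by (i, t), have linear quotients again: at the top
component the colon condition becomes that of the sequence of variables L i
([syzygies_linear_quotients]).  Rows of equal degree have linear syzygies, so
iterating the construction produces a minimal resolution which is linear
([linear_quotients_resolution]).

A squarefree monomial ideal generated in one degree has linear quotients as
soon as its generators satisfy an exchange property
([linear_resolution_of_family]).  When k = 1 the faces are the sets with at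
most two elements, and the generators are all the triples, ordered by the sum
of their elements.  When n <= 2k only step 1 is possible, the facets are
intervals, and the generators are the pairs {i, j} with j - i > k, widest
first.

Now let k >= 2 and n > 2k.  Some pair is not a face, so a linear resolution
would be linear in degree 2.  Then the complex is flag ([triangle_face]), as
the ideal is generated by quadrics, and its graph has no induced 4-cycle
([no_induced_4cycle]), as such a cycle produces a syzygy of degree 4 between
the two missing diagonals which linear syzygies cannot generate.  Let J be the
largest step of a progression.  The pair {1, 1 + kJ} lies in a single facet,
the progression of step J, whereas short steps join its two ends outside this
facet.  If J does not divide k, then 1, 1 + k(J - 1), 1 + kJ is an empty
triangle.  If J divides k, put x = 1 + (k - 1)(J - 1) and y = x + J; the
4-cycle 1, x, y, 1 + kJ has neither 1, y, 1 + kJ nor 1, x, 1 + kJ as a face,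
so it is induced or contains an empty triangle ([vdW_nonlinear]). *)

(** * Spans of selected rows *)

Section Span.
Variable R : comNzRingType.

Definition in_span (r c : nat) (A : 'M[R]_(r, c)) (P : pred 'I_r)
    (v : 'rV[R]_c) : Prop :=
  exists2 u : 'rV[R]_r, (forall j, ~~ P j -> u 0 j = 0) & v = u *m A.

Variables (r c : nat) (A : 'M[R]_(r, c)).
Implicit Types P Q : pred 'I_r.

Lemma in_span_row P i : P i -> in_span A P (row i A).
Proof.
move=> Pi; exists (delta_mx 0 i); last by rewrite rowE.
by move=> j Pj; rewrite mxE /=; case: eqP Pj => // ->; rewrite Pi.
Qed.

Lemma in_spanD P v w : in_span A P v -> in_span A P w -> in_span A P (v + w).
Proof.
move=> [u uP ->] [u' u'P ->]; exists (u + u'); last by rewrite mulmxDl.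
by move=> j Pj; rewrite mxE uP ?u'P ?addr0.
Qed.

Lemma in_spanZ P p v : in_span A P v -> in_span A P (p *: v).
Proof.
move=> [u uP ->]; exists (p *: u); last by rewrite scalemxAl.
by move=> j Pj; rewrite mxE uP ?mulr0.
Qed.

Lemma in_span_sum P (I : Type) (s : seq I) (Q : pred I) (F : I -> 'rV_c) :
  (forall i, Q i -> in_span A P (F i)) ->
  in_span A P (\sum_(i <- s | Q i) F i).
Proof.
move=> FP; elim/big_ind: _ => //; last exact: in_spanD.
by exists 0; [move=> j _; rewrite mxE | rewrite mul0mx].
Qed.

Lemma in_span_sub P Q v :
  (forall j, P j -> Q j) -> in_span A P v -> in_span A Q v.
Proof.
move=> PQ [u uP ->]; exists u => // j Qj; apply: uP.
by apply: contra Qj; apply: PQ.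
Qed.

End Span.

(** * Ideals generated by monomials *)

Section Monomials.
Variables (K : fieldType) (n : nat).
Local Notation R := {mpoly K[n]}.
Implicit Types (m : 'X_{1..n}) (N : {set 'I_n}) (p : R).

Definition mset m : {set 'I_n} := [set i | m i != 0%N].

Lemma squarefree_le N m : (mesym1 N <= m)%MM = (N \subset mset m).
Proof.
apply/mnm_lepP/subsetP => [le i iN|sub i]; last first.
  by rewrite mnmE; case iN: (i \in N); rewrite // lt0n; have := sub i iN; rewrite inE.
by have := le i; rewrite mnmE iN inE; case: (m i).
Qed.

Lemma mset_mesym1 N : mset (mesym1 N) = N.
Proof. by apply/setP=> i; rewrite inE mnmE; case: (i \in N). Qed.

Lemma msetD m m' : mset (m + m') = mset m :|: mset m'.
Proof. by apply/setP=> i; rewrite !inE mnmDE addn_eq0 negb_and. Qed.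

Lemma squarefree_prod N : \prod_(i in N) 'X_i = 'X_[mesym1 N] :> R.
Proof.
rewrite mprodXE; congr 'X_[_]; apply/mnmP=> i; rewrite mnmE mnm_sumE.
under eq_bigr do rewrite mnm1E.
have [iN|iN] := boolP (i \in N); last first.
  by apply: big1 => j jN; case: eqP jN iN => // -> ->.
by rewrite (bigD1 i iN) /= eqxx big1 // => j /andP[_ /negbTE ->].
Qed.

Lemma msuppMXP p m k :
  reflect (exists2 m', m' \in msupp p & k = (m' + m)%MM)
    (k \in msupp (p * 'X_[m])).
Proof.
rewrite (perm_mem (msuppMX _ _)); apply: (iffP mapP) => [] [m' m'p ->];
  by exists m'; rewrite // addmC.
Qed.

Lemma msupp_sum_mem (I : finType) (F : I -> R) m :
  m \in msupp (\sum_i F i) -> exists i, m \in msupp (F i).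
Proof.
rewrite mcoeff_msupp raddf_sum /= => nz.
case: (pickP (fun i => m \in msupp (F i))) => [i mi|no]; first by exists i.
case/eqP: nz; apply: big1 => i _; apply: memN_msupp_eq0.
by rewrite no.
Qed.

(** Every monomial in a combination of monomials is a multiple of one of them;
conversely each term of [p] is divided by one monomial chosen for it.  With the
selection [P], this serves both for ideals and for the colon conditions. *)
Lemma monomial_spanP r (mu : 'I_r -> 'X_{1..n}) (P : pred 'I_r) p :
  in_span (\col_j ('X_[mu j] : R)) P p%:M <->
  {in msupp p, forall m, exists2 j, P j & (mu j <= m)%MM}.
Proof.
split=> [[u uP /matrixP/(_ 0 0)]|pP].
  rewrite !mxE mulr1n => -> m /msupp_sum_mem[j].
  rewrite mxE => /msuppMXP[m' m'u ->]; exists j; last exact: lem_addl.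
  by apply: contraLR m'u => /uP ->; rewrite msupp0.
pose f m := [pick j | P j && (mu j <= m)%MM].
have fE m : m \in msupp p -> exists j, [/\ f m = Some j, P j & (mu j <= m)%MM].
  move=> /pP[j Pj jm]; rewrite /f; case: pickP => [j' /andP[Pj' j'm]|/(_ j)].
    by exists j'.
  by rewrite Pj jm.
exists (\row_j \sum_(m <- msupp p | f m == Some j) p@_m *: 'X_[m - mu j]).
  move=> j Pj; rewrite mxE big1_seq // => m /andP[/eqP fm mp].
  by have [j' [fm' Pj' _]] := fE m mp; move: fm Pj; rewrite fm' => -[<-]; rewrite Pj'.
apply/matrixP=> a b; rewrite !ord1 !mxE mulr1n {1}[p]mpolyE.
transitivity (\sum_j \sum_(m <- msupp p | f m == Some j) p@_m *: ('X_[m] : R)).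
  rewrite (exchange_big_dep predT) //= big_seq [RHS]big_seq; apply: eq_bigr => m mp.
  have [j [fm _ _]] := fE m mp; rewrite (big_pred1 j) // => j'.
  by rewrite fm /=; apply/eqP/eqP => [[]|->].
apply: eq_bigr => j _; rewrite !mxE mulr_suml big_seq_cond [RHS]big_seq_cond.
apply: eq_bigr => m /andP[mp /eqP fm]; have [j' [fm' _ jm]] := fE m mp.
by move: fm; rewrite fm' => -[<-]; rewrite -scalerAl -mpolyXD submK.
Qed.

(** The ideal generated by the variables of [L], described through supports so
that cancelling a variable outside [L] is immediate. *)
Definition in_vars (L : {set 'I_n}) p : Prop :=
  {in msupp p, forall m, exists2 t, t \in L & m t != 0%N}.

Lemma in_varsP L p :
  in_vars L p <->
  exists2 q : 'I_n -> R, (forall t, t \notin L -> q t = 0) &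
    p = \sum_t q t * 'X_t.
Proof.
have [spanP Pspan] := monomial_spanP (fun t => U_(t)%MM) (mem L) p.
split=> [pL|[q qL ->]].
  case: Pspan => [m /pL[t tL mt]|u uL /matrixP/(_ 0 0)]; first by exists t; rewrite ?lep1mP.
  rewrite !mxE mulr1n => ->; exists (u 0) => //.
  by apply: eq_bigr => t _; rewrite mxE.
move=> m /msupp_sum_mem[t] /msuppMXP[m' m'q ->].
exists t; first by apply: contraLR m'q => /qL ->; rewrite msupp0.
by rewrite mnmDE mnm1E eqxx addn1.
Qed.

End Monomials.

(** * Linear quotients and their syzygies *)

Section LinearQuotients.
Variables (K : fieldType) (n : nat).
Local Notation R := {mpoly K[n]}.

Lemma pihomogMr d e (p q : R) :
  q \is e.-homog -> pihomog mdeg (d + e) (p * q) = pihomog mdeg d p * q.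
Proof.
move=> qe; rewrite {1 2}[p]mpolyE mulr_suml !raddf_sum /= mulr_suml.
apply: eq_bigr => m _; rewrite -scalerAl !linearZ /= -scalerAl; congr (_ *: _).
rewrite [in RHS]pihomogX; case: eqP => [<-|md].
  by apply: pihomog_dE; apply: dhomogM => //; rewrite dhomogX.
have qm : 'X_[m] * q \is (mdeg m + e).-homog by apply: dhomogM => //; rewrite dhomogX.
by rewrite mul0r (pihomog_ne0 _ qm) // eqn_add2r; apply/eqP.
Qed.

(** The order on the rows is given by the injective rank [rho] instead of the
index, because the syzygies come indexed by an enumeration of pairs that need
not follow their lexicographic order. *)
Record linear_quotients (r c : nat) (A : 'M[R]_(r, c)) (rho : 'I_r -> nat)
    (L : 'I_r -> {set 'I_n}) : Prop := LinearQuotients {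
  rank_inj : injective rho;
  colonP : forall i p,
    in_span A [pred j | rho j < rho i]%N (p *: row i A) <-> in_vars (L i) p
}.

Section Syzygies.
Variables (r c e : nat) (A : 'M[R]_(r, c)) (rho : 'I_r -> nat).
Variable L : 'I_r -> {set 'I_n}.
Hypothesis lqA : linear_quotients A rho L.
Hypothesis homA : forall i j, A i j \is e.-homog.

Let T : {set 'I_r * 'I_n} := [set x | x.2 \in L x.1].
Let gen (a : 'I_#|T|) : 'I_r := (enum_val a).1.
Let var (a : 'I_#|T|) : 'I_n := (enum_val a).2.

Let varL a : var a \in L (gen a).
Proof. by have := enum_valP a; rewrite inE. Qed.

Let gen_var_inj a b : gen a = gen b -> var a = var b -> a = b.
Proof.
rewrite /gen /var => e1 e2; apply: enum_val_inj.
by move: e1 e2; case: (enum_val a) (enum_val b) => ? ? [? ?] /= -> ->.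
Qed.

Let gen_var_surj i t : t \in L i -> exists2 a, gen a = i & var a = t.
Proof.
move=> tL; have xT : (i, t) \in T by rewrite inE.
by exists (enum_rank_in xT (i, t)); rewrite /gen /var enum_rankK_in.
Qed.

(** The lower part of each syzygy may be taken homogeneous, by extracting the
component of the right degree; this is where the equal degrees of the rows of
[A] enter. *)
Let tails_exist : exists C : 'M[R]_(#|T|, r),
  [/\ forall a j, (rho (gen a) <= rho j)%N -> C a j = 0,
      forall a j, C a j \is 1.-homog
    & forall a, row a C *m A = 'X_(var a) *: row (gen a) A].
Proof.
have tail a : exists u : 'rV[R]_r,
    [/\ forall j, (rho (gen a) <= rho j)%N -> u 0 j = 0,
        forall j, u 0 j \is 1.-homog & u *m A = 'X_(var a) *: row (gen a) A].
  have /(colonP lqA)[u uP uA] : in_vars (L (gen a)) ('X_(var a) : R).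
    move=> m /mem_msuppXP <-; exists (var a); first exact: varL.
    by rewrite mnm1E eqxx.
  exists (\row_j pihomog mdeg 1 (u 0 j)); split=> [j ij|j|].
  - by rewrite mxE uP ?pihomog0 //= -leqNgt.
  - by rewrite mxE pihomogP.
  apply/rowP=> j; move/rowP/(_ j): uA; rewrite !mxE.
  move/(congr1 (pihomog mdeg (1 + e))); rewrite pihomog_dE.
    move=> ->; rewrite raddf_sum /=; apply: eq_bigr => k _.
    by rewrite mxE pihomogMr.
  by apply: dhomogM; rewrite ?homA // dhomogX /= mdeg1.
have [u uP] := fin_all_exists tail.
exists (\matrix_(a, j) u a 0 j); split=> [a j|a j|a].
- by rewrite mxE; case: (uP a) => h _ _; apply: h.
- by rewrite mxE; case: (uP a).
case: (uP a) => _ _ <-; congr (_ *m A).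
by apply/rowP=> j; rewrite !mxE.
Qed.

(** The syzygy attached to row [i] and variable [t] has [t] as its component of
highest rank.  Hence these syzygies span: the top coefficient of any syzygy
lies in the ideal of the variables [L i], so it can be removed.  For the same
reason a multiple [p] of one of them is spanned by the preceding ones only if
[p * t] lies in the ideal of the variables of [L i] smaller than [t], and this
suffices since [s] times the syzygy of [t] minus [t] times that of [s] has
rank lower than [i]. *)
Lemma syzygies_linear_quotients :
  exists r', exists S : 'M[R]_(r', r), exists rho', exists L',
  [/\ linear_quotients S rho' L',
      forall a j, S a j \is 1.-homog
    & forall u : 'rV_r, u *m A = 0 <-> exists v, u = v *m S].
Proof.
have [C [Ctail Chom CA]] := tails_exist.
have [S SE] : exists S : 'M[R]_(#|T|, r),
    forall a j, S a j = 'X_(var a) *+ (gen a == j) - C a j.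
  by exists (\matrix_(a, j) ('X_(var a) *+ (gen a == j) - C a j)) => a j; rewrite mxE.
have SA a : row a S *m A = 0.
  have -> : row a S = 'X_(var a) *: delta_mx 0 (gen a) - row a C.
    by apply/rowP=> j; rewrite !mxE SE eqxx /= mulr_natr eq_sym.
  by rewrite mulmxBl CA -scalemxAl -rowE subrr.
have Sabove a j : (rho (gen a) < rho j)%N -> S a j = 0.
  move=> lt; rewrite SE Ctail ?(ltnW lt) // subr0.
  by case: eqP lt => [->|]; rewrite ?ltnn.
have Sgen a : S a (gen a) = 'X_(var a) by rewrite SE eqxx Ctail ?subr0.
(* The top component of [u] is removed by a combination [w] of the syzygies
   attached to the row [i] of rank [N]. *)
have kernel N (u : 'rV[R]_r) :
    (forall j, (N <= rho j)%N -> u 0 j = 0) -> u *m A = 0 ->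
    in_span S [pred a | rho (gen a) < N]%N u.
  elim: N u => [|N IHN] u uN uA.
    by exists 0; [move=> j _; rewrite mxE|rewrite mul0mx; apply/rowP=> j; rewrite mxE uN].
  case: (pickP (fun i => rho i == N)) => [i /eqP rhoi|noN]; last first.
    apply: (@in_span_sub _ _ _ _ [pred a | rho (gen a) < N]%N).
      by move=> a /=; lia.
    apply: IHN => // j; rewrite leq_eqVlt eq_sym noN /=; exact: uN.
  have /(colonP lqA)/in_varsP[q qL uq] :
      in_span A [pred j | rho j < rho i]%N (u 0 i *: row i A).
    exists (\row_j (if j == i then 0 else - u 0 j)) => [j /=|].
      rewrite mxE; case: eqP => // ji; rewrite -leqNgt => le_ij.
      rewrite uN ?oppr0 //; move: le_ij; rewrite rhoi leq_eqVlt => /orP[/eqP eN|//].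
      by case: ji; apply: (rank_inj lqA); rewrite rhoi.
    apply/rowP=> b; rewrite !mxE; move/rowP/(_ b): uA.
    rewrite !mxE (bigD1 i) //= => /eqP; rewrite addr_eq0 => /eqP ->.
    rewrite [in RHS](bigD1 i) //= mxE eqxx mul0r add0r -sumrN.
    by apply: eq_bigr => k ki; rewrite mxE (negbTE ki) mulNr.
  pose top t := [pick a | (gen a == i) && (var a == t)].
  pose w := \sum_t (if top t is Some a then q t *: row a S else 0).
  have topP t a : top t = Some a -> gen a = i /\ var a = t.
    by rewrite /top; case: pickP => // b /andP[/eqP ? /eqP ?] [<-].
  have wN : in_span S [pred a | rho (gen a) < N.+1]%N w.
    apply: in_span_sum => t _; case ta: (top t) => [a|].
      by apply/in_spanZ/in_span_row; rewrite /= (topP _ _ ta).1 rhoi.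
    by exists 0; [move=> j _; rewrite mxE|rewrite mul0mx].
  have wi : w 0 i = u 0 i.
    rewrite uq summxE; apply: eq_bigr => t _; case ta: (top t) => [a|].
      by have [<- <-] := topP _ _ ta; rewrite !mxE Sgen.
    rewrite mxE qL ?mul0r //; apply/negP => /gen_var_surj[a ga va].
    by move: ta; rewrite /top; case: pickP => // /(_ a); rewrite ga va !eqxx.
  have wA : w *m A = 0.
    rewrite mulmx_suml big1 // => t _; case: (top t) => [a|]; last exact: mul0mx.
    by rewrite -scalemxAl SA scaler0.
  rewrite -[u](subrK w); apply: in_spanD => //.
  apply: (@in_span_sub _ _ _ _ [pred a | rho (gen a) < N]%N).
    by move=> a /=; lia.
  apply: IHN => [j|]; last by rewrite mulmxBl uA wA subr0.
  rewrite leq_eqVlt => /orP[/eqP eN|lt_N].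
    have -> : j = i by apply: (rank_inj lqA); rewrite rhoi.
    by rewrite mxE [X in _ + X]mxE wi subrr.
  rewrite mxE [X in _ + X]mxE uN // summxE big1 ?subrr // => t _.
  case ta: (top t) => [a|]; rewrite !mxE ?Sabove ?mulr0 //.
  by rewrite (topP _ _ ta).1 rhoi.
(* Since [var a < n], this is the lexicographic order on pairs. *)
pose rho' a := (rho (gen a) * n + var a)%N.
have rho'_lt a b : (rho' b < rho' a)%N =
    (rho (gen b) < rho (gen a))%N || (gen b == gen a) && (var b < var a)%N.
  have := ltn_ord (var a); have := ltn_ord (var b); rewrite /rho'.
  case: eqP => [-> _ _|/eqP ne lta ltb]; first by rewrite ltnn ltn_add2l.
  have {}ne : rho (gen b) != rho (gen a) by rewrite (inj_eq (rank_inj lqA)).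
  rewrite orbF; apply/idP/idP; nia.
exists #|T|, S, rho', (fun a => [set t in L (gen a) | t < var a]%N); split.
- split=> [a b eq_ab|a p].
    have := rho'_lt a b; have := rho'_lt b a; rewrite eq_ab ltnn.
    move=> /esym/negbT; rewrite negb_or => /andP[n1 n2].
    move=> /esym/negbT; rewrite negb_or => /andP[n3 n4].
    have gab : gen a = gen b by apply: (rank_inj lqA); lia.
    apply: gen_var_inj => //; apply: val_inj => /=.
    by move: n2 n4; rewrite gab eqxx /=; lia.
  split=> [[u uP uS] m mp|].
    (* Read the relation at the top component of row [a]. *)
    move/rowP/(_ (gen a)): uS; rewrite !mxE Sgen => eq_p.
    have : (m + U_(var a))%MM \in msupp (p * 'X_(var a)) by apply/msuppMXP; exists m.
    rewrite eq_p => /msupp_sum_mem[b].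
    have [lt_ba|/uP ->] := boolP (rho' b < rho' a)%N; last by rewrite mul0r msupp0.
    move: lt_ba; rewrite rho'_lt => /orP[lt_ba|/andP[/eqP gba lt_ba]].
      by rewrite Sabove // mulr0 msupp0.
    rewrite -gba Sgen => /msuppMXP[m' _ /mnmP/(_ (var b))].
    rewrite !mnmDE !mnm1E eqxx; case: eqP lt_ba => [->|_]; first by rewrite ltnn.
    rewrite addn0 => lt_ba m_b; exists (var b); last by rewrite m_b addn1.
    by rewrite inE varL lt_ba.
  move=> /in_varsP[q qL ->]; rewrite scaler_suml.
  apply: in_span_sum => t _.
  have [|/qL ->] := boolP (t \in [set t in L (gen a) | t < var a]%N); last first.
    by exists 0; [move=> j _; rewrite mxE|rewrite mul0r scale0r mul0mx].
  rewrite inE => /andP[/gen_var_surj[b gb vb] lt_ta]; rewrite -scalerA.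
  apply: in_spanZ.
  (* [b] is the syzygy of the same row and the smaller variable [t]; the two
     multiples have the same top component. *)
  rewrite -[_ *: row a S](subrK ('X_(var a) *: row b S)).
  apply: in_spanD; last first.
    by apply/in_spanZ/in_span_row; rewrite /= rho'_lt gb eqxx vb lt_ta orbT.
  apply: (@in_span_sub _ _ _ _ [pred b | rho (gen b) < rho (gen a)]%N).
    by move=> b' /= lt; rewrite rho'_lt lt.
  apply: kernel => [j|]; last by rewrite mulmxBl -!scalemxAl !SA !scaler0 subrr.
  rewrite leq_eqVlt => /orP[/eqP/(rank_inj lqA) <-|lt_j].
    by rewrite !mxE Sgen -gb Sgen vb mulrC subrr.
  by rewrite !mxE !Sabove ?gb ?mulr0 ?subrr.
- move=> a j; rewrite SE; apply: rpredB; last exact: Chom.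
  by case: eqP => _; rewrite ?mulr1n ?mulr0n ?dhomogX ?rpred0 //= mdeg1.
move=> u; split=> [uA|[v ->]]; last first.
  rewrite -mulmxA; suff -> : S *m A = 0 by rewrite mulmx0.
  by apply/row_matrixP=> a; rewrite row_mul SA row0.
have [|v _ ->] := kernel (\max_j rho j).+1 u _ uA; last by exists v.
by move=> j; rewrite ltnNge leq_bigmax.
Qed.
End Syzygies.
End LinearQuotients.

(** * Iterated syzygies *)

Section LinearResolution.
Variables (K : fieldType) (n : nat).
Local Notation R := {mpoly K[n]}.

(** One step of the resolution.  The rank and the variables are hidden so that
a step determines the next one through its matrix alone. *)
Record stage (c : nat) := Stage {
  rows : nat;
  mat : 'M[R]_(rows, c);
  stageP : exists rho L e,
    linear_quotients mat rho L /\ forall i j, mat i j \is e.-homog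
}.

Definition is_syzygy_stage c (s : stage c) (s' : stage (rows s)) : Prop :=
  (forall i j, mat s' i j \is 1.-homog) /\
  (forall u : 'rV_(rows s), u *m mat s = 0 <-> exists v, u = v *m mat s').

Lemma next_stage_exists c (s : stage c) : exists s', @is_syzygy_stage c s s'.
Proof.
have [rho [L [e [lqA homA]]]] := stageP s.
have [r' [S [rho' [L' [lqS homS kerS]]]]] := syzygies_linear_quotients lqA homA.
have Sp : exists rho L e, linear_quotients S rho L /\ forall i j, S i j \is e.-homog.
  by exists rho', L', 1%N.
by exists (Stage Sp).
Qed.

Definition next_stage c (s : stage c) : stage (rows s) :=
  proj1_sig (constructive_indefinite_description _ (next_stage_exists s)).

Lemma next_stageP c (s : stage c) : is_syzygy_stage (next_stage s).
Proof. exact: proj2_sig (constructive_indefinite_description _ _). Qed.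

(** Pairing each step with its number of columns makes the number of columns
of step [i.+1] convertible to the number of rows of step [i]. *)
Fixpoint tower (s : stage 1) (i : nat) : {c : nat & stage c} :=
  if i is i'.+1 then existT stage _ (next_stage (projT2 (tower s i')))
  else existT stage 1%N s.

Definition tower_sequence (s : stage 1) (d : nat) : free_sequence K n :=
  @FreeSequence K n (fun i => rows (projT2 (tower s i))) (fun i _ => (i + d)%N)
    (mat (projT2 (tower s 0))) (fun i => mat (projT2 (tower s i.+1))).

Lemma linear_quotients_resolution r (A : 'cV[R]_r) rho L d (I : R -> Prop) :
  linear_quotients A rho L -> (forall i, A i 0 \is d.-homog) ->
  (forall p, I p <-> exists u, u *m A = p%:M) ->
  exists F : free_sequence K n, minimal_graded_free_resolution F I /\
    forall i (a : 'I_(rk F i)), shift a = (i + d)%N.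
Proof.
move=> lqA homA genI.
have Ap : exists rho L e, linear_quotients A rho L /\ forall i j, A i j \is e.-homog.
  by exists rho, L, d; split=> // i j; rewrite ord1.
pose s := Stage Ap; exists (tower_sequence s d); split=> //.
have lin i : forall a b, diff (tower_sequence s d) i a b \is 1.-homog.
  by case: (next_stageP (projT2 (tower s i))).
have ker i (u : 'rV_(rows (projT2 (tower s i)))) :
    u *m mat (projT2 (tower s i)) = 0 <->
    exists v, u = v *m diff (tower_sequence s d) i.
  exact: (next_stageP (projT2 (tower s i))).2.
split.
- split=> [a|i a b m mF] /=; first exact: homA.
  by have /dhomogP/(_ _ mF)/= -> := lin i a b; rewrite add1n.
- split=> [p|u|i u]; [exact: genI|exact: (ker 0%N u)|exact: (ker i.+1 u)].
- move=> i a b; apply: (dhomog_nemf_coeff (lin i a b)).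
  by rewrite /= mdeg0.
Qed.
End LinearResolution.

(** * Squarefree monomial ideals with linear quotients *)

Section MonomialFamilies.
Variables (K : fieldType) (n : nat).
Local Notation R := {mpoly K[n]}.
Implicit Types (D : simplicial_complex n) (p : R) (s : seq R) (N : {set 'I_n}).

Lemma ideal_genE s p :
  ideal_gen s p <-> in_span (\col_(i < size s) s`_i) xpredT p%:M.
Proof.
split=> [[c ->]|[u _ /matrixP/(_ 0 0)]].
  exists (\row_i c i) => //; apply/matrixP=> i j.
  by rewrite !ord1 !mxE mulr1n; apply: eq_bigr => k _; rewrite !mxE.
rewrite !mxE mulr1n => ->; exists (u 0).
by apply: eq_bigr => k _; rewrite mxE.
Qed.

Lemma ideal_gen_mem s g : g \in s -> ideal_gen s g.
Proof.
move=> gs; apply/ideal_genE; have lt : (index g s < size s)%N by rewrite index_mem.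
have -> : g%:M = row (Ordinal lt) (\col_(i < size s) s`_i).
  by apply/matrixP=> i j; rewrite !ord1 !mxE mulr1n nth_index.
exact: in_span_row.
Qed.

Lemma ideal_gen_comb s (J : finType) (c F : J -> R) :
  (forall j, ideal_gen s (F j)) -> ideal_gen s (\sum_j c j * F j).
Proof.
move=> Fs; apply/ideal_genE.
have -> : (\sum_j c j * F j)%:M = \sum_j c j *: (F j)%:M :> 'M[R]_1.
  by rewrite raddf_sum; apply: eq_bigr => j _; rewrite scale_scalar_mx.
by apply: in_span_sum => j _; apply/in_spanZ/ideal_genE.
Qed.

(** The ideal is spanned by the monomials whose support is not a face, since
non-faces are closed under supersets. *)
Lemma stanley_reisnerP D p :
  stanley_reisner K D p <-> {in msupp p, forall m, mset m \notin faces D}.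
Proof.
rewrite /stanley_reisner; set s := image _ _; rewrite ideal_genE.
have sz : size s = #|~: faces D| by rewrite size_image.
pose N (i : 'I_(size s)) := enum_val (cast_ord sz i).
have sE (i : 'I_(size s)) : s`_i = 'X_[mesym1 (N i)].
  rewrite -squarefree_prod /s /image_mem (nth_map set0); last by rewrite -cardE -sz.
  by rewrite /N (enum_val_nth set0).
have -> : \col_(i < size s) s`_i = \col_i ('X_[mesym1 (N i)] : R).
  by apply/colP=> i; rewrite !mxE sE.
rewrite monomial_spanP; split=> pD m /pD.
  case=> i _; rewrite squarefree_le => Nm; apply/negP => mD.
  have := enum_valP (cast_ord sz i); rewrite in_setC => /negP[].
  exact: faces_closed mD Nm.
move=> mD; have mF : mset m \in ~: faces D by rewrite in_setC.
exists (cast_ord (esym sz) (enum_rank_in mF (mset m))) => //.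
by rewrite squarefree_le /N cast_ordKV enum_rankK_in.
Qed.

(** Elements of the ideal have no terms of degree below [d], so a generator of
degree other than [d] contributes nothing to the part of degree [d], which
already generates the ideal: irredundance excludes it. *)
Lemma homog_minimal_generators r (A : 'cV[R]_r) d (I : R -> Prop) s :
  (forall i, A i 0 \is d.-homog) ->
  (forall p, I p <-> exists u, u *m A = p%:M) ->
  minimal_generators I s -> forall g, g \in s -> g \is d.-homog.
Proof.
move=> homA genI [homs sI irr].
have I_low p m : I p -> m \in msupp p -> (d <= mdeg m)%N.
  case/genI=> u /matrixP/(_ 0 0); rewrite !mxE mulr1n => <- /msupp_sum_mem[j].
  move=> /msuppM_le/allpairsP[[m1 m2] /= [_ m2A ->]].
  by have /dhomogP/(_ _ m2A)/= <- := homA j; rewrite mdegD leq_addl.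
pose t := [seq g <- s | g \is d.-homog].
suff tI p : I p <-> ideal_gen t p.
  have ts : t = s by apply: irr => //; apply: filter_subseq.
  by move=> g; rewrite -ts mem_filter => /andP[].
split; last first.
  case=> c ->; apply/sI; apply: ideal_gen_comb => j; apply: ideal_gen_mem.
  have : t`_j \in t by rewrite mem_nth.
  by rewrite mem_filter => /andP[].
case/genI=> u /matrixP/(_ 0 0); rewrite !mxE mulr1n => <-.
apply: ideal_gen_comb => j.
have /sI[c Ac] : I (A j 0).
  apply/genI; exists (delta_mx 0 j); rewrite -rowE.
  by apply/matrixP=> a b; rewrite !ord1 !mxE mulr1n.
rewrite -(pihomog_dE (homA j)) Ac raddf_sum /=.
pose e (i : 'I_(size s)) := if s`_i \is d.-homog then pihomog mdeg 0 (c i) else 0.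
pose f (i : 'I_(size s)) := if s`_i \is d.-homog then s`_i else 0.
rewrite (eq_bigr (fun i => e i * f i)) => [|i _].
  apply: ideal_gen_comb => i; rewrite /f; case: ifP => [hi|_].
    by apply: ideal_gen_mem; rewrite mem_filter hi mem_nth.
  by apply/ideal_genE; exists 0 => //; rewrite mul0mx raddf0.
have si : s`_i \in s by rewrite mem_nth.
rewrite /e /f; case: ifP => [hi|/negP hi]; first by rewrite -[in LHS](add0n d) pihomogMr.
rewrite mul0r pihomogE big1_seq // => m /andP[/eqP md].
move=> /msuppM_le/allpairsP[[m1 m2] /= [_ m2s mE]]; case: hi.
have [b hb] := homs _ si; have := I_low _ m2 ((sI _).2 (ideal_gen_mem si)) m2s.
have /dhomogP/(_ _ m2s)/= eb := hb; rewrite eb => le_db.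
have -> : d = b; last by [].
by apply/eqP; rewrite eqn_leq le_db -md /= mE mdegD eb leq_addl.
Qed.

(** Ordering the generators by [kappa], ties being broken arbitrarily, the
colon ideal of the generator [N] is generated by the variables [t] outside [N]
such that [t |: N] contains a generator with smaller [kappa]. *)
Lemma linear_resolution_of_family D (F : {set {set 'I_n}}) d
    (kappa : {set 'I_n} -> nat) :
  (0 < d)%N -> {in F, forall N, #|N| = d} ->
  (forall N, N \notin faces D <-> exists2 N', N' \in F & N' \subset N) ->
  {in F &, forall N N', N' != N -> (kappa N' <= kappa N)%N ->
     exists t, exists N'', [/\ t \in N' :\: N, N'' \in F,
       N'' \subset t |: N & (kappa N'' < kappa N)%N]} ->
  linear_resolution (stanley_reisner K D).
Proof.
move=> d_gt0 cardF nonfaces exchange.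
pose N (j : 'I_#|F|) := enum_val j.
have NF j : N j \in F by apply: enum_valP.
pose A : 'cV[R]_#|F| := \col_j 'X_[mesym1 (N j)].
have homA j : A j 0 \is d.-homog.
  by rewrite mxE dhomogX /= mdeg_mesym1 cardF.
have genA p : stanley_reisner K D p <-> exists u, u *m A = p%:M.
  rewrite stanley_reisnerP.
  have [spanP Pspan] := monomial_spanP (fun j => mesym1 (N j)) xpredT p.
  split=> [pD|[u uA]].
    case: Pspan => [m /pD/nonfaces[N' N'F N'm]|u _ uA]; last by exists u.
    exists (enum_rank_in N'F N') => //=.
    by rewrite squarefree_le /N enum_rankK_in.
  move=> m mp; apply/nonfaces; case: (spanP _ m mp) => [|j _ /=]; first by exists u.
  by rewrite squarefree_le => Njm; exists (N j).
(* The index only breaks ties, as it is smaller than [#|F|]. *)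
pose rho j := (kappa (N j) * #|F| + j)%N.
pose L j := [set t | (t \notin N j) && [exists N' in F,
  (kappa N' < kappa (N j))%N && (N' \subset t |: N j)]].
have lqA : linear_quotients A rho L.
  split=> [i j|j p].
    move/(congr1 (modn^~ #|F|)); rewrite /rho /= !modnMDl !modn_small //.
    exact: val_inj.
  have -> : p *: row j A = (p * 'X_[mesym1 (N j)])%:M.
    by apply/matrixP=> a b; rewrite !ord1 !mxE mulr1n.
  rewrite (monomial_spanP (fun j => mesym1 (N j))); split=> [pspan m mp|pL k].
    have [|i /= lt_ij] := pspan (m + mesym1 (N j))%MM; first by apply/msuppMXP; exists m.
    rewrite squarefree_le msetD mset_mesym1 => /subsetP Ni.
    have neq : N i != N j.
      apply: contraTneq lt_ij => /enum_val_inj ->; by rewrite ltnn.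
    have le_kappa : (kappa (N i) <= kappa (N j))%N.
      move: lt_ij; rewrite /rho; have := ltn_ord i; have := ltn_ord j; nia.
    have [t [N'' []]] := exchange _ _ (NF j) (NF i) neq le_kappa.
    rewrite inE => /andP[tNj tNi] N''F sub lt; exists t.
      rewrite inE tNj; apply/existsP; exists N''; by rewrite N''F lt.
    by have := Ni t tNi; rewrite !inE (negbTE tNj) orbF.
  case/msuppMXP=> m /pL[t tL mt] ->; move: tL.
  rewrite inE => /andP[tN /existsP[N' /andP[N'F /andP[lt sub]]]].
  exists (enum_rank_in N'F N') => /=.
    rewrite /rho /N enum_rankK_in //.
    apply: (@leq_trans ((kappa N').+1 * #|F|)).
      by rewrite mulSn addnC ltn_add2r.
    by apply: leq_trans (leq_addr _ _); rewrite leq_mul2r lt orbT.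
  rewrite squarefree_le /N enum_rankK_in // msetD mset_mesym1.
  by apply: subset_trans sub _; rewrite setSU // sub1set inE.
have [Fr [Fmin Fshift]] := linear_quotients_resolution lqA homA genA.
exists d, (fun i j => #|[set a : 'I_(rk Fr i) | shift a == j]|); split=> //.
- by move=> s; apply: homog_minimal_generators homA genA.
- by exists Fr.
move=> i j jd; apply: eq_card0 => a; rewrite !inE Fshift eqn_add2l.
by apply/eqP=> dj; apply: jd.
Qed.
End MonomialFamilies.

(** * The van der Waerden complexes with linear resolution *)

Section VanDerWaerdenFaces.
Implicit Types n k : nat.

Lemma vdW_faceP n k (F : {set 'I_n}) : (0 < k)%N ->
  reflect (exists a j, [/\ (0 < a)%N, (0 < j)%N, (a + k * j <= n)%N
      & {in F, forall i : 'I_n, exists2 m, (m <= k)%N & i.+1 = (a + m * j)%N}])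
    (F \in faces (vdW n k)).
Proof.
move=> k_gt0; rewrite inE; apply: (iffP existsP).
  case=> _ /andP[/imsetP[[a j] /= + ->] /subsetP FP].
  rewrite inE /= => /and3P[a_gt0 j_gt0 le_n]; exists a, j; split=> // i /FP.
  by rewrite inE => /existsP[m /eqP ->]; exists m; rewrite // -ltnS.
case=> a [j [a_gt0 j_gt0 le_n FP]].
have lt_a : (a < n.+1)%N by lia.
have lt_j : (j < n.+1)%N by nia.
exists (progression n k a j); apply/andP; split.
  by apply/imsetP; exists (Ordinal lt_a, Ordinal lt_j); rewrite // inE /= a_gt0 j_gt0.
apply/subsetP=> i /FP[m le_mk im]; rewrite inE; apply/existsP.
by exists (inord m); rewrite inordK // im.
Qed.

Lemma vdW1_face n (N : {set 'I_n}) : (1 < n)%N ->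
  (N \in faces (vdW n 1)) = (#|N| <= 2)%N.
Proof.
move=> n_gt1; apply/idP/idP.
  rewrite inE => /existsP[_ /andP[/imsetP[[a j] /= + ->] NP]].
  rewrite inE /= => /and3P[a_gt0 j_gt0 le_n].
  by have := subset_leq_card NP; rewrite card_progression.
have pair (i j : 'I_n) : (i < j)%N -> [set i; j] \in faces (vdW n 1).
  move=> lt_ij; apply/vdW_faceP=> //; exists i.+1, (j - i)%N.
  split; rewrite ?mul1n ?subn_gt0 //; first by have := ltn_ord j; lia.
  by move=> h; rewrite !inE => /orP[]/eqP->; [exists 0%N|exists 1%N] => //; lia.
have sub_pair (i j : 'I_n) : i != j -> N \subset [set i; j] -> N \in faces (vdW n 1).
  rewrite -val_eqE neq_ltn => /orP[] lt_ij.
    by apply: faces_closed (pair _ _ lt_ij).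
  by rewrite setUC; apply: faces_closed (pair _ _ lt_ij).
pose o0 := Ordinal (ltnW n_gt1); pose o1 := Ordinal n_gt1.
have o01 : o0 != o1 by [].
rewrite leq_eqVlt => /orP[/cards2P[i [j [ij NE]]]|].
  by apply: (sub_pair i j); rewrite // NE.
rewrite ltnS leq_eqVlt => /orP[/cards1P[i NE]|].
  have [ei|ni] := eqVneq i o0; last by apply: (sub_pair i o0); rewrite // NE subsetUl.
  by apply: (sub_pair i o1); rewrite ?ei // NE ei subsetUl.
by rewrite ltnS leqn0 cards_eq0 => /eqP N0; apply: (sub_pair o0 o1); rewrite // N0 sub0set.
Qed.

Definition wide_pairs n k : {set {set 'I_n}} :=
  [set [set x.1; x.2] | x : 'I_n * 'I_n & (x.1 + k < x.2)%N].

Lemma wide_pairsP n k (N : {set 'I_n}) :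
  reflect (exists i j : 'I_n, (i + k < j)%N /\ N = [set i; j])
    (N \in wide_pairs n k).
Proof.
apply: (iffP imsetP) => [[[i j]]|[i [j [lt ->]]]].
  by rewrite inE /= => lt ->; exists i, j.
by exists (i, j); rewrite // inE.
Qed.

(** Since [n <= 2 * k], a progression with [k] steps has step 1, so that faces
are the sets contained in an interval of length [k]. *)
Lemma vdW_half_nonface n k (N : {set 'I_n}) :
  (0 < k)%N -> (k < n)%N -> (n <= k.*2)%N ->
  N \notin faces (vdW n k) <-> exists2 N', N' \in wide_pairs n k & N' \subset N.
Proof.
move=> k_gt0 lt_kn le_n; split; last first.
  case=> _ /wide_pairsP[i [j [lt_ij ->]]] /subsetP sub.
  have iN : i \in N by apply: sub; rewrite !inE eqxx.
  have jN : j \in N by apply: sub; rewrite !inE eqxx orbT.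
  apply/negP => /(vdW_faceP _ k_gt0)[a [b [a_gt0 b_gt0 le_ab P]]].
  have [m _ im] := P i iN; have [m' le_m' jm'] := P j jN.
  (* A step [b >= 2] would give [a + k * b > n]. *)
  have b1 : b = 1%N by nia.
  by subst b; lia.
case: (boolP [exists x : 'I_n * 'I_n,
  [&& x.1 \in N, x.2 \in N & x.1 + k < x.2]%N]).
  case/existsP=> [[i j] /= /and3P[iN jN lt_ij] _].
  exists [set i; j]; first by apply/wide_pairsP; exists i, j.
  by apply/subsetP=> h; rewrite !inE => /orP[]/eqP->.
move=> /existsPn narrow; case/negP; apply/vdW_faceP => //.
have [->|[i0 i0N]] := set_0Vmem N.
  by exists 1%N, 1%N; split=> // [|i]; rewrite ?inE //; lia.
case: (arg_minnP (fun i : 'I_n => val i) i0N) => i i_in imin.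
have {i_in} iN : i \in N := i_in.
exists (minn i.+1 (n - k)), 1%N; split=> //; try lia.
move=> j jN; exists (j.+1 - minn i.+1 (n - k))%N.
  have := narrow (i, j); rewrite /= iN jN /= -leqNgt.
  by have := ltn_ord j; lia.
by have /= := imin j jN; have := ltn_ord j; lia.
Qed.

Lemma card_wide_pairs n k : {in wide_pairs n k, forall N : {set 'I_n}, #|N| = 2%N}.
Proof.
move=> _ /wide_pairsP[i [j [lt_ij ->]]]; rewrite cards2.
by case: eqP lt_ij => // -> ; lia.
Qed.

(** The difference of the two elements of a pair: subtraction is truncated. *)
Definition gap n (N : {set 'I_n}) := (\sum_(i in N) \sum_(j in N) (j - i))%N.

Lemma gap_pair n (i j : 'I_n) : (i < j)%N -> gap [set i; j] = (j - i)%N.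
Proof.
move=> lt_ij; have ij : i \notin [set j] by rewrite inE -val_eqE ltn_eqF.
by rewrite /gap !big_setU1 //= !big_set1 !big_setU1 //= !big_set1; lia.
Qed.

(** If [N'] is at least as wide as [N] and differs from it, then it sticks out
of [N] on the left or on the right; moving that end of [N] outwards makes [N]
wider. *)
Lemma wide_pairs_exchange n k :
  {in wide_pairs n k &, forall N N' : {set 'I_n},
     N' != N -> (n - gap N' <= n - gap N)%N ->
     exists t, exists N'', [/\ t \in N' :\: N, N'' \in wide_pairs n k,
       N'' \subset t |: N & (n - gap N'' < n - gap N)%N]}.
Proof.
move=> _ _ /wide_pairsP[i [i' [lt_i ->]]] /wide_pairsP[j [j' [lt_j ->]]] neq.
have := (ltn_ord i', ltn_ord j') => -[ltn ltn'].
rewrite !gap_pair; try lia; move=> le_gap.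
have [lt_ji|le_ij] := ltnP j i.
  exists j, [set j; i']; split.
  - by rewrite !inE eqxx -!val_eqE /=; lia.
  - by apply/wide_pairsP; exists j, i'; split=> //; lia.
  - by apply/subsetP=> h; rewrite !inE => /orP[]->; rewrite ?orbT.
  by rewrite gap_pair; lia.
have lt' : (i' < j')%N.
  rewrite ltnNge; apply: contra neq => le'.
  have -> : j = i by apply: val_inj => /=; lia.
  by have -> : j' = i' by apply: val_inj => /=; lia.
exists j', [set i; j']; split.
- by rewrite !inE eqxx -!val_eqE /=; lia.
- by apply/wide_pairsP; exists i, j'; split=> //; lia.
- by apply/subsetP=> h; rewrite !inE => /orP[]->; rewrite ?orbT.
by rewrite gap_pair; lia.
Qed.

Definition weight n (N : {set 'I_n}) := (\sum_(i in N) i)%N.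

(** Otherwise every element of [N :\: N'] is smaller than every element of
[N' :\: N]; these sets have the same positive cardinal, so [N'] would have the
larger sum. *)
Lemma weight_swap n (N N' : {set 'I_n}) :
  #|N| = #|N'| -> N' != N -> (weight N' <= weight N)%N ->
  exists t, exists s, [/\ t \in N' :\: N, s \in N :\: N' & (t < s)%N].
Proof.
move=> cardNN' neq le_w.
have cardD : #|N :\: N'| = #|N' :\: N| by rewrite !cardsD setIC cardNN'.
have le_wD : (\sum_(t in N' :\: N) t <= \sum_(s in N :\: N') s)%N.
  move: le_w; rewrite /weight (big_setID N) [in X in (_ <= X)%N -> _](big_setID N') /=.
  by rewrite setIC leq_add2l.
case: (pickP [pred x : 'I_n * 'I_n |
    [&& x.1 \in N' :\: N, x.2 \in N :\: N' & (x.1 < x.2)%N]]) => [[t s] /= /and3P[]|no].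
  by exists t, s.
have D_gt0 : (0 < #|N :\: N'|)%N.
  rewrite card_gt0; apply: contra neq => /eqP D0.
  by rewrite eqEsubset -!setD_eq0 D0 eqxx andbT -cards_eq0 -cardD D0 cards0.
have [s0 s0D] := card_gt0P D_gt0.
case: (arg_maxnP (fun i : 'I_n => val i) s0D) => s s_in smax.
have {s_in} sD : s \in N :\: N' := s_in.
have lt_s t : t \in N' :\: N -> (s < t)%N.
  move=> tD; have := no (t, s); rewrite /= tD sD /= => /negbT; rewrite -leqNgt.
  rewrite leq_eqVlt => /orP[/eqP/val_inj e|//].
  by move: sD tD; rewrite !inE e => /andP[/negP sN' _] /andP[_ /sN'].
have up : (\sum_(i in N :\: N') i <= #|N :\: N'| * s)%N.
  by rewrite -sum_nat_const; apply: leq_sum => i iD; exact: (smax i iD).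
have down : (#|N :\: N'| * s.+1 <= \sum_(i in N' :\: N) i)%N.
  by rewrite cardD -sum_nat_const; apply: leq_sum => i; apply: lt_s.
by have := leq_trans down (leq_trans le_wD up); rewrite mulnS; lia.
Qed.

Lemma uniform_exchange n d :
  {in [set N : {set 'I_n} | #|N| == d] &, forall N N' : {set 'I_n},
     N' != N -> (weight N' <= weight N)%N ->
     exists t, exists N'', [/\ t \in N' :\: N,
       N'' \in [set N : {set 'I_n} | #|N| == d],
       N'' \subset t |: N & (weight N'' < weight N)%N]}.
Proof.
move=> N N'; rewrite !inE => /eqP cN /eqP cN' neq le_w.
have [|t [s [tD sD lt_ts]]] := weight_swap _ neq le_w; first by rewrite cN.
move: (tD) (sD); rewrite !inE => /andP[tN _] /andP[_ sN].
have tNs : t \notin N :\ s by rewrite !inE (negbTE tN) andbF.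
exists t, (t |: (N :\ s)); split=> //.
- by rewrite inE cardsU1 tNs -cN (cardsD1 s N) sN.
- by rewrite setUS // subsetDl.
by rewrite /weight big_setU1 //= (big_setD1 s sN) /= ltn_add2r.
Qed.

Lemma vdW1_linear_resolution n (K : fieldType) : (1 < n)%N ->
  linear_resolution (stanley_reisner K (vdW n 1)).
Proof.
move=> n_gt1.
apply: (@linear_resolution_of_family _ _ _ _ 3 (@weight n) _ _ _ (@uniform_exchange n 3)).
- by [].
- by move=> N; rewrite inE => /eqP.
move=> N; rewrite vdW1_face // -ltnNge; split=> [/card_geqP[s [us ss sN]]|[N']].
  exists [set x in s]; first by rewrite inE cardsE (card_uniqP us) ss.
  by apply/subsetP=> x; rewrite inE; apply: sN.
by rewrite inE => /eqP cN' /subset_leq_card; rewrite cN'.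
Qed.

Lemma vdW_half_linear_resolution n k (K : fieldType) :
  (0 < k)%N -> (k < n)%N -> (n <= k.*2)%N ->
  linear_resolution (stanley_reisner K (vdW n k)).
Proof.
move=> k_gt0 lt_kn le_n.
apply: (@linear_resolution_of_family _ _ _ (wide_pairs n k) 2
  (fun N => n - gap N)%N _ _ _ (@wide_pairs_exchange n k)) => //.
- exact: card_wide_pairs.
by move=> N; apply: vdW_half_nonface.
Qed.

End VanDerWaerdenFaces.

(** * Obstructions to linearity in degree two *)

Section LinearObstructions.
Variables (K : fieldType) (n : nat).
Local Notation R := {mpoly K[n]}.
Implicit Types (p q : R) (m : 'X_{1..n}).

Lemma mcoeff_pihomog d p m :
  (pihomog mdeg d p)@_m = if mdeg m == d then p@_m else 0.
Proof.
rewrite pihomogE {3}[p]mpolyE !raddf_sum /= big_mkcond /=.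
case: ifP => md; [apply: eq_bigr|apply: big1] => m' _;
  case: eqP => [m'd|/eqP m'd]; rewrite ?mcoeffZ ?mcoeffX //;
  case: eqP => [e|_]; rewrite ?mulr0 //.
- by rewrite e md in m'd.
- by rewrite -e m'd eqxx in md.
Qed.

(** Among the terms of [p], only the constant one leaves the degree of [q]
unchanged. *)
Lemma mcoeffM_homog e p q m :
  q \is e.-homog -> mdeg m = e -> (p * q)@_m = p@_0%MM * q@_m.
Proof.
move=> qe me; have := mcoeff_pihomog e (p * q) m; rewrite me eqxx => <-.
rewrite -[X in pihomog _ X _](add0n e) pihomogMr //.
suff -> : pihomog mdeg 0 p = (p@_0%MM)%:MP by rewrite mcoeffCM.
apply/mpolyP=> k; rewrite mcoeff_pihomog mcoeffC mdeg_eq0.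
by case: eqP => [->|_]; rewrite ?mulr1 ?mulr0.
Qed.

Lemma linear_formE p : p \is 1.-homog -> p = \sum_t p@_(U_(t)) *: 'X_t.
Proof.
move=> p1; apply/mpolyP=> m; rewrite raddf_sum /=.
under eq_bigr do rewrite mcoeffZ mcoeffX.
have [/eqP/mdeg1P[i /eqP ->]|m1] := eqVneq (mdeg m) 1%N.
  rewrite (bigD1 i) //= eqxx mulr1 big1 ?addr0 // => j ji.
  by rewrite eq_mnm1 (negbTE ji) mulr0.
rewrite (dhomog_nemf_coeff p1 m1) big1 // => t _.
by case: (_ =P m) m1 => [<-|_ _]; rewrite ?mdeg1 ?mulr0.
Qed.

Lemma mcoeff_linearM p q m : p \is 1.-homog ->
  (p * q)@_m = \sum_(t | m t != 0%N) p@_(U_(t)) * q@_(m - U_(t)).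
Proof.
move=> p1; rewrite {1}(linear_formE p1) mulr_suml raddf_sum /= [RHS]big_mkcond.
apply: eq_bigr => t _; rewrite -scalerAl mcoeffZ ['X_t * q]mulrC.
have [mt|mt] := boolP (m t != 0%N).
  have mE : (U_(t) + (m - U_(t)))%MM = m by rewrite addmC submK // lep1mP.
  by rewrite -[in LHS]mE mcoeffMX.
rewrite [(q * 'X_t)@_m]memN_msupp_eq0 ?mulr0 //; apply/negP => /msuppMXP[m' _ mE].
by move: mt; rewrite mE mnmDE mnm1E eqxx addn1.
Qed.

Lemma leq_card_mset m : (#|mset m| <= mdeg m)%N.
Proof.
rewrite mdegE -sum1_card big_mkcond /=; apply: leq_sum => i _.
by rewrite inE; case: (m i).
Qed.

(** Only generators and first syzygies are used to refute linearity.  The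
vanishing of the Betti numbers says nothing about shifts [shift a < 1] at step
1, but the corresponding rows vanish by homogeneity. *)
Lemma linear_resolution_first_steps (I : R -> Prop) :
  linear_resolution I ->
  exists d (F : free_sequence K n),
    [/\ resolves F I, forall a, aug F a 0 \is d.-homog
      & forall a b, diff F 0 a b \is 1.-homog].
Proof.
case=> d [beta [d_gt0 _ [F [[grF resF _] betaE]] beta0]].
have shift_d i (a : 'I_(rk F i)) j : shift a = (i + j)%N -> j = d.
  move=> aj; apply/eqP/negPn/negP => /eqP/(beta0 i) /eqP.
  by rewrite betaE cards_eq0 => /eqP/setP/(_ a); rewrite !inE aj eqxx.
have shift0 (a : 'I_(rk F 0)) : shift a = d by apply: (shift_d 0%N).
exists d, F; split=> // [a|a b].
  by rewrite -(shift0 a); apply: grF.1.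
apply/dhomogP => m /grF.2 /=; rewrite shift0.
case sa: (shift a) => [|j]; first by lia.
by rewrite (shift_d 1%N a j) //; lia.
Qed.

Section Obstructions.
Variable D : simplicial_complex n.
Hypothesis small_faces : forall N : {set 'I_n}, (#|N| <= 1)%N -> N \in faces D.
Variables (F : free_sequence K n) (d : nat).
Hypothesis resF : resolves F (stanley_reisner K D).
Hypothesis homF : forall a, aug F a 0 \is d.-homog.
Hypothesis linF : forall a b, diff F 0 a b \is 1.-homog.

Lemma monomial_in_ideal m : mset m \notin faces D ->
  exists u : 'rV_(rk F 0), \sum_j u 0 j * aug F j 0 = 'X_[m].
Proof.
move=> mD; have [genF _ _] := resF.
have /genF[u /matrixP/(_ 0 0)] : stanley_reisner K D 'X_[m].
  by apply/stanley_reisnerP => m' /mem_msuppXP <-.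
by rewrite !mxE mulr1n => <-; exists u.
Qed.

Lemma aug_nonface j m : m \in msupp (aug F j 0) -> mset m \notin faces D.
Proof.
have [genF _ _] := resF; move: m.
apply/stanley_reisnerP/genF; exists (delta_mx 0 j); rewrite -rowE.
by apply/matrixP=> a b; rewrite !ord1 !mxE mulr1n.
Qed.

(** The monomial of [N] is a combination of the homogeneous generators, so one
of their terms, of degree [d], divides it. *)
Lemma nonface_has_generator (N : {set 'I_n}) : N \notin faces D ->
  exists N' : {set 'I_n},
    [/\ N' \notin faces D, N' \subset N, (#|N'| <= d)%N & (d <= #|N|)%N].
Proof.
rewrite -{1}(mset_mesym1 N) => /monomial_in_ideal[u uE].
have : mesym1 N \in msupp (\sum_j u 0 j * aug F j 0) by rewrite uE msuppX inE.
case/msupp_sum_mem=> j /msuppM_le/allpairsP[[m1 m2] /= [_ m2F NE]].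
have m2d : mdeg m2 = d by have /dhomogP/(_ _ m2F) := homF j.
exists (mset m2); split; first exact: aug_nonface m2F.
- by rewrite -(mset_mesym1 N) NE msetD subsetUr.
- by rewrite -m2d leq_card_mset.
by rewrite -mdeg_mesym1 NE mdegD m2d leq_addl.
Qed.

Lemma degree2 (i j : 'I_n) : [set i; j] \notin faces D -> d = 2%N.
Proof.
move=> /nonface_has_generator[N' [N'D _ le_N'd le_d]].
apply/eqP; rewrite eqn_leq; apply/andP; split.
  by apply: leq_trans le_d _; rewrite cards2; case: (_ != _).
apply: leq_trans le_N'd; rewrite ltnNge; apply: contra N'D.
exact: small_faces.
Qed.

Hypothesis d2 : d = 2%N.

(** Some quadratic term of the ideal divides the monomial of an empty triangle,
and its support would be a missing edge. *)
Lemma triangle_face (x y z : 'I_n) :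
  [set x; y] \in faces D -> [set y; z] \in faces D -> [set x; z] \in faces D ->
  [set x; y; z] \in faces D.
Proof.
move=> xy yz xz; apply/negPn/negP => xyz.
have [N' [N'D sub le_N' _]] := nonface_has_generator xyz.
have xN : x \in N'.
  apply: contraR N'D => xN; apply: faces_closed yz _; apply/subsetP=> t tN.
  by have := subsetP sub t tN; rewrite !inE; case: eqP tN xN => //= -> ->.
have yN : y \in N'.
  apply: contraR N'D => yN; apply: faces_closed xz _; apply/subsetP=> t tN.
  have := subsetP sub t tN; rewrite !inE.
  by case: (t =P y) tN yN => [-> -> //|]; rewrite orbF.
have zN : z \in N'.
  apply: contraR N'D => zN; apply: faces_closed xy _; apply/subsetP=> t tN.
  have := subsetP sub t tN; rewrite !inE.
  by case: (t =P z) tN zN => [-> -> //|]; rewrite orbF.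
have NE : N' = [set x; y; z].
  by apply/eqP; rewrite eqEsubset sub /= !subUset !sub1set xN yN zN.
have nxy : x != y by apply: contraNneq xyz => ->; rewrite setUid.
have nyz : y != z by apply: contraNneq xyz => ->; rewrite -setUA setUid.
have nxz : x != z by apply: contraNneq xyz => ->; rewrite setUAC setUid setUC.
move: le_N'; rewrite NE d2 setUC cardsU1 cards2 !inE nxy.
by rewrite ![z == _]eq_sym (negbTE nxz) (negbTE nyz).
Qed.

(** With [m0] and [m1] the monomials of the missing diagonals, write each as a
combination [u], [v] of the generators; then [m1 u - m0 v] is a syzygy.  Map a
row [w] to the sum of its entries weighted by the coefficients of [m0] in the
generators.  The image of a linear syzygy does not involve the variables [b]
and [e]: its coefficient at [b] is that of the monomial [a b c] in the
relation, because [a b] and [b c] are faces and do not occur in the generators;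
likewise at [e].  So the image of any combination of linear syzygies has
coefficient 0 at [m1 = b e], whereas [m1 u - m0 v] gives 1. *)
Lemma no_induced_4cycle (a b c e : 'I_n) :
  [set a; b] \in faces D -> [set b; c] \in faces D ->
  [set c; e] \in faces D -> [set a; e] \in faces D ->
  [set a; c] \notin faces D -> [set b; e] \notin faces D -> False.
Proof.
move=> ab bc ce ae ac be.
pose m0 := (U_(a) + U_(c))%MM; pose m1 := (U_(b) + U_(e))%MM.
have msetU2 x y : mset (U_(x) + U_(y))%MM = [set x; y] :> {set 'I_n}.
  by rewrite msetD -!mesym1_set1 !mset_mesym1.
have [u uE] : exists u : 'rV_(rk F 0), \sum_j u 0 j * aug F j 0 = 'X_[m0].
  by apply: monomial_in_ideal; rewrite msetU2.
have [v vE] : exists v : 'rV_(rk F 0), \sum_j v 0 j * aug F j 0 = 'X_[m1].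
  by apply: monomial_in_ideal; rewrite msetU2.
have [_ kerF _] := resF.
have /kerF[y wE] : ('X_[m1] *: u - 'X_[m0] *: v) *m aug F = 0.
  rewrite mulmxBl -!scalemxAl; apply/matrixP=> i j; rewrite !ord1 !mxE uE vE.
  by rewrite mulrC subrr.
have row_vanish i t : t \in [set b; e] ->
    \sum_j (diff F 0 i j)@_U_(t) * (aug F j 0)@_m0 = 0.
  move=> tbe; have ta : [set a; t] \in faces D by move: tbe; rewrite !inE => /orP[]/eqP->.
  have tc : [set c; t] \in faces D.
    by move: tbe; rewrite !inE => /orP[]/eqP->; rewrite // setUC.
  have at_ : a != t by apply: contraTneq tc => <-; rewrite setUC.
  have ct : c != t by apply: contraTneq ta => <-.
  have : row i (diff F 0) *m aug F = 0.
    by apply/kerF; exists (delta_mx 0 i); rewrite rowE.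
  move=> /matrixP/(_ 0 0); rewrite !mxE => /(congr1 (mcoeff (m0 + U_(t))%MM)).
  rewrite raddf_sum /= mcoeff0 => coef0; rewrite -[RHS]coef0; apply: eq_bigr => j _.
  rewrite mxE mcoeff_linearM // (bigD1 t) /=; last by rewrite mnmDE mnm1E eqxx addn1.
  rewrite addmK big1 ?addr0 // => s /andP[ms st].
  suff -> : (aug F j 0)@_(m0 + U_(t) - U_(s)) = 0 by rewrite mulr0.
  apply: memN_msupp_eq0; apply/negP => /aug_nonface.
  have /orP : (a == s) || (c == s).
    move: ms; rewrite !mnmDE !mnm1E [t == s]eq_sym (negbTE st) addn0.
    by case: (a == s); case: (c == s).
  case=> /eqP <-.
  - by rewrite /m0 [(U_(a) + _)%MM]addmC -addmA [(U_(a) + _)%MM]addmC addmA addmK msetU2 tc.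
  - by rewrite /m0 -addmA [(U_(c) + _)%MM]addmC addmA addmK msetU2 ta.
have sum0 : \sum_j ((y *m diff F 0) 0 j)@_m1 * (aug F j 0)@_m0 = 0.
  transitivity (\sum_j \sum_i \sum_(t | m1 t != 0%N)
      (y 0 i)@_(m1 - U_(t)) * ((diff F 0 i j)@_U_(t) * (aug F j 0)@_m0)).
    apply: eq_bigr => j _; rewrite mxE raddf_sum mulr_suml; apply: eq_bigr => i _.
    rewrite mulrC /= [y 0 i * _]mulrC mcoeff_linearM // mulr_sumr.
    by apply: eq_bigr => t _; ring.
  rewrite exchange_big big1 //= => i _; rewrite exchange_big big1 //= => t mt.
  rewrite -mulr_sumr row_vanish ?mulr0 //.
  move: mt; rewrite mnmDE !mnm1E !inE ![_ == t]eq_sym.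
  by case: (t == b); case: (t == e).
have ab' : a != b by apply: contraTneq bc => <-.
have ae' : a != e by apply: contraTneq ce => <-; rewrite setUC.
have one : \sum_j (u 0 j * aug F j 0)@_m0 = 1.
  by rewrite -raddf_sum uE /= mcoeffX eqxx.
have zero : \sum_j (u 0 j * aug F j 0)@_m0 = 0.
  rewrite -[RHS]sum0; apply: eq_bigr => j _.
  rewrite (@mcoeffM_homog 2) ?mdegD ?mdeg1 //; last by rewrite -d2.
  congr (_ * _); rewrite -wE !mxE mcoeffB ['X_[m1] * _]mulrC ['X_[m0] * _]mulrC.
  rewrite -[X in _@_X - _](addm0 m1) mcoeffMX [(v 0 j * _)@_m1]memN_msupp_eq0 ?subr0 //.
  apply/negP => /msuppMXP[m' _ /mnmP/(_ a)].
  by rewrite !mnmDE !mnm1E eqxx ![_ == a]eq_sym (negbTE ab') (negbTE ae') !addnS.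
by move/eqP: zero; rewrite one oner_eq0.
Qed.
End Obstructions.
End LinearObstructions.

(** * The van der Waerden complexes without linear resolution *)

Section VanDerWaerdenNonlinear.
Implicit Types n k : nat.

Lemma vdW_near_pair n k (i j : 'I_n) : (0 < k)%N -> (k < n)%N ->
  (i <= j)%N -> (j <= i + k)%N -> [set i; j] \in faces (vdW n k).
Proof.
move=> k_gt0 lt_kn le_ij le_jik; apply/vdW_faceP => //.
exists (minn i.+1 (n - k)), 1%N; have := ltn_ord j; split=> //; try lia.
move=> h hij; exists (h.+1 - minn i.+1 (n - k))%N;
  by move: hij; rewrite !inE => /orP[]/eqP->; lia.
Qed.

Lemma vdW_small_face n k (N : {set 'I_n}) : (0 < k)%N -> (k < n)%N ->
  (#|N| <= 1)%N -> N \in faces (vdW n k).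
Proof.
move=> k_gt0 lt_kn; have o : 'I_n by exists k.
have single (i : 'I_n) : [set i] \in faces (vdW n k).
  by rewrite -[[set i]]setUid; apply: vdW_near_pair => //; lia.
rewrite leq_eqVlt => /orP[/cards1P[i ->]|]; first exact: single.
rewrite ltnS leqn0 cards_eq0 => /eqP ->.
exact: faces_closed (single o) (sub0set _).
Qed.

(** If a progression with [k] steps contains the first vertex and one of the
last two, the distance of these vertices is divisible by [k].  As [k > 1], this
cannot be so for both distances [n - 1] and [n - 2]. *)
Lemma vdW_missing_edge n k : (1 < k)%N -> (k.*2 < n)%N ->
  exists i j : 'I_n, [set i; j] \notin faces (vdW n k).
Proof.
move=> k_gt1 lt_n; have k_gt0 : (0 < k)%N by lia.
have lt0 : (0 < n)%N by lia.
have lt1 : (n - 1 < n)%N by lia.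
have lt2 : (n - 2 < n)%N by lia.
pose o := Ordinal lt0.
have step (h : 'I_n) : (n - 2 <= h)%N -> [set o; h] \in faces (vdW n k) ->
    exists b, h = (k * b)%N :> nat.
  move=> le_h /(vdW_faceP _ k_gt0)[a [b [a_gt0 b_gt0 le_ab P]]].
  have [|m _ /= om] := P o; first by rewrite !inE eqxx.
  have [|m' le_m' hm'] := P h; first by rewrite !inE eqxx orbT.
  have a1 : a = 1%N by lia.
  subst a; have hE : (h = m' * b :> nat)%N by lia.
  exists b; have := ltn_ord h => lt_h.
  have [mk|ne_m'] := eqVneq m' k; first by rewrite hE mk.
  have : (m'.+1 * b <= k * b)%N by rewrite leq_mul2r; lia.
  rewrite mulSn -hE => le_b; have b1 : b = 1%N by lia.
  by subst b; lia.
have [f1|] := boolP ([set o; Ordinal lt1] \in faces (vdW n k)); last by exists o, (Ordinal lt1).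
have [f2|] := boolP ([set o; Ordinal lt2] \in faces (vdW n k)); last by exists o, (Ordinal lt2).
have [|b1 /= e1] := step _ _ f1; first by rewrite /=; lia.
have [|b2 /= e2] := step _ _ f2; first by rewrite /=; lia.
have : (k * (b1 - b2) = 1)%N by rewrite mulnBr -e1 -e2; lia.
by move/eqP; rewrite muln_eq1; lia.
Qed.

(** Vertices are counted from 0 here.  The edge from [o = 0] to [z = k * J]
lies only in the progression of step [J], so a vertex forming a face with it is
a multiple of [J]. *)
Lemma vdW_nonlinear n k (K : fieldType) : (1 < k)%N -> (k.*2 < n)%N ->
  ~ linear_resolution (stanley_reisner K (vdW n k)).
Proof.
move=> k_gt1 lt_2k; have k_gt0 : (0 < k)%N by lia.
have lt_kn : (k < n)%N by lia.
case/linear_resolution_first_steps=> d [F [resF homF linF]].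
have small N := @vdW_small_face n k N k_gt0 lt_kn.
have d2 : d = 2%N.
  have [i [j ij]] := vdW_missing_edge k_gt1 lt_2k.
  exact: (degree2 small resF homF ij).
have triangle := triangle_face resF homF d2.
have square := no_induced_4cycle resF homF linF d2.
have [J [J_ge2 le_J J_max]] : exists J, [/\ 2 <= J, k * J <= n - 1
    & forall b, k * b <= n - 1 -> b <= J]%N.
  exists ((n - 1) %/ k)%N; split=> [||b le_b].
  - by rewrite leq_divRL //; lia.
  - by rewrite mulnC leq_trunc_div.
  by rewrite leq_divRL // mulnC.
have lt_o : (0 < n)%N by lia.
have lt_z : (k * J < n)%N by lia.
pose o := Ordinal lt_o; pose z := Ordinal lt_z.
have from_o (h : 'I_n) m j : (m <= k)%N -> (0 < j <= J)%N -> h = (m * j)%N :> nat ->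
    [set o; h] \in faces (vdW n k).
  move=> le_mk /andP[j_gt0 le_jJ] hE; apply/vdW_faceP => //; exists 1%N, j.
  split=> //; first by have : (k * j <= k * J)%N; [rewrite leq_mul2l le_jJ orbT|lia].
  by move=> i; rewrite !inE => /orP[]/eqP->; [exists 0%N|exists m]; rewrite ?hE.
have oz : [set o; z] \in faces (vdW n k) by apply: (from_o z k J); rewrite ?leqnn //; lia.
have link_oz (h : 'I_n) : [set o; h; z] \in faces (vdW n k) -> (J %| h)%N.
  case/(vdW_faceP _ k_gt0)=> a [b [a_gt0 b_gt0 le_ab P]].
  have [|m _ /= om] := P o; first by rewrite !inE eqxx.
  have [|mz le_mz /= zm] := P z; first by rewrite !inE eqxx !orbT.
  have [|mh _ /= hm] := P h; first by rewrite !inE eqxx !orbT.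
  have a1 : a = 1%N by lia.
  subst a; have le_bJ : (b <= J)%N by apply: J_max; lia.
  have bJ : b = J.
    apply/eqP; rewrite eqn_leq le_bJ -(leq_pmul2l k_gt0).
    have : (mz * b <= k * b)%N by rewrite leq_mul2r le_mz orbT.
    lia.
  by apply/dvdnP; exists mh; rewrite -bJ; lia.
have [Jk|nJk] := boolP (J %| k)%N; last first.
  have lt_x : (k * (J - 1) < n)%N by rewrite mulnBr; lia.
  pose x := Ordinal lt_x; case/negP: nJk.
  have : [set o; x; z] \in faces (vdW n k).
    apply: triangle => //; first by apply: (from_o x k (J - 1)%N) => //; lia.
    by apply: vdW_near_pair; rewrite //= mulnBr; nia.
  move/link_oz; rewrite /= mulnBr muln1 => dv.
  by have := dvdn_sub (dvdn_mull k (dvdnn J)) dv; rewrite subKn //; nia.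
(* From now on [J] divides [k]: the path [o], [x], [y], [z] uses the steps
   [J - 1], 1 and 1, and neither [x] nor [y] is a multiple of [J]. *)
have le_Jk : (J <= k)%N by apply: dvdn_leq.
have nJy : ~~ (J %| k * J - (k - 1))%N.
  apply/negP=> dv.
  have : (J %| k - 1)%N.
    by have := dvdn_sub (dvdn_mull k (dvdnn J)) dv; rewrite subKn //; nia.
  by rewrite dvdn_subr ?dvdn1 //; lia.
have xE : ((k - 1) * (J - 1) = k * J - (k - 1) - J)%N by nia.
have lt_x : ((k - 1) * (J - 1) < n)%N by lia.
have lt_y : (k * J - (k - 1) < n)%N by lia.
pose x := Ordinal lt_x; pose y := Ordinal lt_y.
have le_J_y : (J <= k * J - (k - 1))%N by nia.
have ox : [set o; x] \in faces (vdW n k).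
  by apply: (from_o x (k - 1)%N (J - 1)%N) => //; lia.
have xy : [set x; y] \in faces (vdW n k) by apply: vdW_near_pair; rewrite //= xE; lia.
have yz : [set y; z] \in faces (vdW n k) by apply: vdW_near_pair; rewrite //=; lia.
apply: (square o x y z) => //; apply/negP => diagonal.
  have : [set o; y; z] \in faces (vdW n k) by apply: triangle.
  by move/link_oz; rewrite /= (negbTE nJy).
have : [set o; x; z] \in faces (vdW n k) by apply: triangle.
move/link_oz; rewrite /= xE => dv; case/negP: nJy.
by rewrite -(subnK le_J_y) dvdn_addl.
Qed.

End VanDerWaerdenNonlinear.

Local Close Scope ring_scope.

Theorem theorem1p1 (n k : nat) (K : fieldType) (hk : 0 < k) (hkn : k < n) :
  linear_resolution (stanley_reisner K (vdW n k)) <->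
  (k = 1 \/ (n%:R / 2%:R <= k%:R :> rat)%R /\ k < n).
Proof.
have -> : (n%:R / 2%:R <= k%:R :> rat)%R = (n <= k.*2).
  by rewrite Num.Theory.ler_pdivrMr ?Num.Theory.ltr0n // -natrM Num.Theory.ler_nat muln2.
split=> [lin|[k1|[le_n _]]].
- have [k1|k_neq1] := eqVneq k 1; [by left|right; split=> //].
  rewrite leqNgt; apply/negP => lt_n; move: lin.
  by apply: vdW_nonlinear; lia.
- by rewrite k1 in hkn *; apply: vdW1_linear_resolution.
exact: vdW_half_linear_resolution.
Qed.
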